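(* Let $([\underline{A};\overline{A}],O,B,U)$ be a PCS, and let $L\in\mathbb{R}^{k\times n}$ be the result of the algorithm CLUE applied to $\underline{A}$ and $\overline{A}$ with output matrix $O$; that is, $L$ is the matrix in reduced (row) echelon form, of rank $k$, which is a constrained lumping of both $\underline{A}$ and $\overline{A}$ with respect to $O$, where $k$ is minimal among the ranks of all constrained lumpings of both $\underline{A}$ and $\overline{A}$ with respect to $O$. If $L$ is not proper, then there is no constrained proper positive lumping of the PCS with row space of dimension $k$.
   Context: Notation. $\operatorname{rs}(L)$ is the row space of a matrix $L$. The order $\le$ on matrices is component-wise, and $[\underline{A};\overline{A}]$ is the set of matrices $M$ with $\underline{A}\le M\le\overline{A}$. A matrix is Metzler if its off-diagonal entries are non-negative. PCS. A positive controlled system (PCS) $([\underline{A};\overline{A}],O,B,U)$ is given by $\partial_t x(t)=A(t)x(t)+Bu(t)$, $z(t)=Ox(t)$, where $O\in\mathbb{R}^{l\times n}$, $B\in\mathbb{R}_{\ge0}^{n\times m}$, $\underline{A},\overline{A}\in\mathbb{R}^{n\times n}$ are Metzler with $\underline{A}\le\overline{A}$, $U\subseteq\mathbb{R}_{\ge0}^m$ is compact and contains the origin, and $A(\cdot)\in[\underline{A};\overline{A}]$, $u(\cdot)\in U$ are piecewise continuous with right limits. Lumpings. $L\in\mathbb{R}^{k\times n}$ of rank $k\le n$ is a constrained lumping of $A\in\mathbb{R}^{n\times n}$ with respect to $O$ if $\operatorname{rs}(O)\subseteq\operatorname{rs}(L)$ and $\operatorname{rs}(LA)\subseteq\operatorname{rs}(L)$.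 A matrix $L\in\mathbb{R}^{k\times n}$ is proper if it has non-negative entries, has rank $k\le n$, and its rows have pairwise disjoint supports. $L$ is a constrained proper positive lumping of the PCS if it is proper and is a constrained lumping of both $\underline{A}$ and $\overline{A}$ with respect to $O$. CLUE is a known algorithm which, given $\underline{A},\overline{A},O$, outputs a matrix with exactly the properties listed in the claim (a full-row-rank matrix in reduced echelon form that is a constrained lumping of both $\underline A$ and $\overline A$ with respect to $O$, with minimal row space dimension $k$). *)

(* Defs.v *)
From mathcomp Require Import all_boot all_order all_algebra.
From mathcomp Require Import classical_sets reals topology normedtype.
Set Implicit Arguments.
Unset Strict Implicit.
Unset Printing Implicit Defensive.
Import Order.TTheory GRing.Theory Num.Theory.
Import numFieldNormedType.Exports.
Local Open Scope classical_set_scope.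
Local Open Scope ring_scope.

Definition mx_le (R : realType) (p q : nat) (A B : 'M[R]_(p, q)) : Prop :=
  forall i j, A i j <= B i j.

Definition metzler (R : realType) (n : nat) (A : 'M[R]_n) : Prop :=
  forall i j, i != j -> 0 <= A i j.

(* The data ([pcs_Alo; pcs_Ahi], O, B, U) of the positive controlled system
     x'(t) = A(t) x(t) + B u(t),   z(t) = O x(t),
   with A(t) in [pcs_Alo; pcs_Ahi] and u(t) in U for all t, A(.) and u(.)
   piecewise continuous with right limits; [pcs_Alo; pcs_Ahi] is the set of
   matrices between pcs_Alo and pcs_Ahi, so it is recorded by its bounds. *)
Record pcs (R : realType) (n m l : nat) := PCS {
  pcs_Alo : 'M[R]_n;
  pcs_Ahi : 'M[R]_n;
  pcs_O : 'M[R]_(l, n);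
  pcs_B : 'M[R]_(n, m);
  pcs_U : set 'cV[R]_m;
  pcs_Alo_metzler : metzler pcs_Alo;
  pcs_Ahi_metzler : metzler pcs_Ahi;
  pcs_Alo_le_Ahi : mx_le pcs_Alo pcs_Ahi;
  pcs_B_ge0 : mx_le 0 pcs_B;
  pcs_U_ge0 : forall u, pcs_U u -> mx_le 0 u;
  pcs_U_compact : compact pcs_U;
  pcs_U_0 : pcs_U 0
}.

Definition constrained_lumping (R : realType) (n l k : nat)
    (A : 'M[R]_n) (O : 'M[R]_(l, n)) (L : 'M[R]_(k, n)) : Prop :=
  [/\ \rank L = k, (O <= L)%MS & (L *m A <= L)%MS].

Definition common_constrained_lumping (R : realType) (n m l k : nat)
    (S : pcs R n m l) (L : 'M[R]_(k, n)) : Prop :=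
  constrained_lumping (pcs_Alo S) (pcs_O S) L /\
  constrained_lumping (pcs_Ahi S) (pcs_O S) L.

Definition proper_mx (R : realType) (n k : nat) (L : 'M[R]_(k, n)) : Prop :=
  [/\ mx_le 0 L, \rank L = k &
      forall i1 i2 j, i1 != i2 -> ~ (L i1 j != 0 /\ L i2 j != 0)].

Definition constrained_proper_positive_lumping (R : realType) (n m l k : nat)
    (S : pcs R n m l) (L : 'M[R]_(k, n)) : Prop :=
  proper_mx L /\ common_constrained_lumping S L.

Definition leading_entry (R : realType) (n k : nat) (L : 'M[R]_(k, n))
    (i : 'I_k) (j : 'I_n) : Prop :=
  L i j != 0 /\ forall j' : 'I_n, (j' < j)%N -> L i j' = 0.

Definition row_echelon (R : realType) (n k : nat) (L : 'M[R]_(k, n)) : Prop :=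
  (forall i1 i2 : 'I_k, (i1 < i2)%N -> row i1 L = 0 -> row i2 L = 0) /\
  (forall (i1 i2 : 'I_k) (j1 j2 : 'I_n), (i1 < i2)%N ->
     leading_entry L i1 j1 -> leading_entry L i2 j2 -> (j1 < j2)%N).

Definition reduced_row_echelon (R : realType) (n k : nat)
    (L : 'M[R]_(k, n)) : Prop :=
  row_echelon L /\
  forall (i : 'I_k) (j : 'I_n), leading_entry L i j ->
    L i j = 1 /\ forall i' : 'I_k, i' != i -> L i' j = 0.

(* The specification of the output of CLUE on the two matrices pcs_Alo S and
   pcs_Ahi S with output matrix pcs_O S. *)
Definition clue_result (R : realType) (n m l k : nat)
    (S : pcs R n m l) (L : 'M[R]_(k, n)) : Prop :=
  [/\ reduced_row_echelon L,
      common_constrained_lumping S L &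
      forall (k' : nat) (L' : 'M[R]_(k', n)),
        common_constrained_lumping S L' -> (k <= \rank L')%N].

(* Main.v *)
Require Import Defs.
From mathcomp Require Import all_boot all_order all_algebra.
From mathcomp Require Import fingroup perm.
From mathcomp Require Import classical_sets reals topology normedtype.

(** The row space of a constrained lumping of both bounding matrices is a
    subspace that contains the rows of [O] and is invariant under both
    matrices, and such subspaces are closed under intersection.  A common
    lumping of minimal rank therefore has its row space inside that of every
    other common lumping ([clue_row_space_min]); one of the same rank has the
    very same row space.

    It remains to see that a space spanned by a proper matrix [L'] has a proper
    reduced echelon basis ([proper_reduced_row_echelon]).  In reduced echelon
    form the pivot columns of [L] form an identity matrix, so the coordinates of
    a row of [L'] in the rows of [L] are just its entries at the pivots: the
    change of basis [D], with [L' = D *m L], is a submatrix of [L'].  It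
    inherits from [L'] that entries are non-negative and that no column has two
    non-zero entries; being invertible, it is a permutation matrix up to
    positive factors ([monomial_mx]).  So the rows of [L] are those of [L'],
    permuted and rescaled by positive numbers, and [L] is proper too. *)

Set Implicit Arguments.
Unset Strict Implicit.
Unset Printing Implicit Defensive.
Import Order.TTheory GRing.Theory Num.Theory.
Local Open Scope ring_scope.

Lemma row_free_row_neq0 (F : fieldType) (k n : nat) (A : 'M[F]_(k, n)) i :
  row_free A -> row i A != 0.
Proof.
move=> freeA; rewrite rowE mulmx_free_eq0 //.
apply/eqP => /rowP /(_ i); rewrite !mxE !eqxx /=.
by apply/eqP; rewrite oner_eq0.
Qed.

(** Picking a non-zero entry in each row is an injection of the rows into the
    columns, hence a bijection because the matrix is square; so there is no room
    for a second non-zero entry in any row. *)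
Lemma monomial_mx (F : fieldType) (k : nat) (D : 'M[F]_k) :
    (forall i, row i D != 0) ->
    (forall i1 i2 j, D i1 j != 0 -> D i2 j != 0 -> i1 = i2) ->
  exists s : {perm 'I_k},
    forall i, D i (s i) != 0 /\ forall j, j != s i -> D i j = 0.
Proof.
move=> row_neq0 colD.
have /fin_all_exists [s Ds] i : exists j, D i j != 0.
  by have /rV0Pn [j] := row_neq0 i; rewrite mxE; exists j.
have s_inj : injective s.
  move=> i1 i2 e12; apply: (colD i1 i2 (s i1)); first exact: Ds.
  by rewrite e12; apply: Ds.
exists (perm s_inj) => i; rewrite permE; split=> [|j]; first exact: Ds.
have [s' _ s'K] := injF_bij s_inj.
apply: contraNeq => Dij.
by rewrite (colD _ _ _ Dij (_ : D (s' j) j != 0)) ?s'K // -{2}[j]s'K.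
Qed.

Lemma leading_entry_exists (R : realType) (k n : nat) (L : 'M[R]_(k, n)) i :
  row i L != 0 -> exists j, leading_entry L i j.
Proof.
move=> /rV0Pn [j0]; rewrite mxE => Lij0.
case: (arg_minnP (fun j : 'I_n => j : nat)
  (Lij0 : (fun j => L i j != 0) j0)) => j Lij jmin.
exists j; split=> // j' lt_j'j; apply/eqP; apply: contraTT lt_j'j => Lij'.
by rewrite -leqNgt jmin.
Qed.

(** Both matrices have [k] independent rows, so the inclusion [(L' <= L)%MS] is
    an equality of row spaces: [L] is the reduced echelon basis of the space
    spanned by [L']. *)
Lemma proper_reduced_row_echelon (R : realType) (k n : nat)
    (L L' : 'M[R]_(k, n)) :
    reduced_row_echelon L -> \rank L = k -> proper_mx L' -> (L' <= L)%MS ->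
  proper_mx L.
Proof.
move=> [_ redL] rankL [L'_ge0 rankL' L'_disj] /submxP [D defL'].
have freeL : row_free L by rewrite /row_free rankL.
have freeL' : row_free L' by rewrite /row_free rankL'.
have /fin_all_exists [p pivot] i : exists j, leading_entry L i j.
  exact/leading_entry_exists/row_free_row_neq0.
(* [p i] is the pivot column of row [i], where [L] has the [i]-th unit
   vector. *)
have DE t i : D t i = L' t (p i).
  have [Lip Lp] := redL _ _ (pivot i).
  rewrite defL' mxE (bigD1 i) //= Lip mulr1 big1 ?addr0 // => i' ne_i'i.
  by rewrite Lp ?mulr0.
have rowD t : row t D != 0.
  have := row_free_row_neq0 t freeL'; apply: contraNneq => D0.
  by rewrite defL' row_mul D0 mul0mx.
have colD t1 t2 i : D t1 i != 0 -> D t2 i != 0 -> t1 = t2.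
  rewrite !DE => n1 n2; apply/eqP/negPn/negP => ne12.
  exact: (L'_disj _ _ (p i) ne12).
have [s Ds] := monomial_mx rowD colD.
have L'E t j : L' t j = D t (s t) * L (s t) j.
  rewrite {1}defL' mxE (bigD1 (s t)) //= big1 ?addr0 // => i ne_i.
  by rewrite (Ds t).2 ?mul0r.
split=> // [i j|i1 i2 j ne12 [Lj1 Lj2]].
  set t := s^-1%g i; have <- : s t = i by rewrite permKV.
  have Dt_gt0 : 0 < D t (s t).
    by have := L'_ge0 t (p (s t)); rewrite mxE -DE lt_def (Ds t).1.
  by have := L'_ge0 t j; rewrite !mxE L'E pmulr_rge0.
apply: (L'_disj (s^-1%g i1) (s^-1%g i2) j).
  by rewrite (inj_eq perm_inj).
have L'_neq0 i : L i j != 0 -> L' (s^-1%g i) j != 0.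
  by move=> Lij; rewrite L'E mulf_neq0 ?(Ds _).1 // permKV.
by split; apply: L'_neq0.
Qed.

(** A lumping has full row rank, so the intersection of the row spaces, which
    [(L1 :&: L2)%MS] represents by a square matrix, is given by a basis. *)
Lemma cap_constrained_lumping (R : realType) (n l k1 k2 : nat)
    (A : 'M[R]_n) (O : 'M[R]_(l, n)) (L1 : 'M[R]_(k1, n)) (L2 : 'M[R]_(k2, n)) :
    constrained_lumping A O L1 -> constrained_lumping A O L2 ->
  constrained_lumping A O (row_base (L1 :&: L2)%MS).
Proof.
move=> [_ O1 A1] [_ O2 A2]; split.
- by rewrite eq_row_base.
- by rewrite eq_row_base sub_capmx O1.
- rewrite eq_row_base sub_capmx; apply/andP; split.
    apply: submx_trans A1; rewrite submxMr // eq_row_base; exact: capmxSl.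
  apply: submx_trans A2; rewrite submxMr // eq_row_base; exact: capmxSr.
Qed.

(** Otherwise the intersection of the two row spaces would be a common lumping
    of smaller rank. *)
Lemma clue_row_space_min (R : realType) (n m l k k' : nat) (S : pcs R n m l)
    (L : 'M[R]_(k, n)) (L' : 'M[R]_(k', n)) :
  clue_result S L -> common_constrained_lumping S L' -> (L <= L')%MS.
Proof.
move=> [_ [lo hi] Lmin] [lo' hi'].
have rankL : \rank L = k by case: lo.
have := Lmin _ _ (conj (cap_constrained_lumping lo lo')
                       (cap_constrained_lumping hi hi')).
rewrite eq_row_base -{1}rankL => rank_cap.
apply: submx_trans (capmxSr L L').
by rewrite -(geq_leqif (mxrank_leqif_sup (capmxSl L L'))).
Qed.

Theorem theorem3 (R : realType) (n m l k : nat) (S : pcs R n m l)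
    (L : 'M[R]_(k, n)) (hL : clue_result S L) (hnp : ~ proper_mx L) :
  ~ exists (k' : nat) (L' : 'M[R]_(k', n)),
      constrained_proper_positive_lumping S L' /\ \rank L' = k.
Proof.
move=> [k' [L' [[properL' lumpL'] rankL']]].
have [_ ek _] := properL'; rewrite rankL' in ek.
subst k'; apply: hnp.
have [redL [[rankL _ _] _] _] := hL.
apply: (proper_reduced_row_echelon redL rankL properL').
have sLL' := clue_row_space_min hL lumpL'.
by rewrite -(geq_leqif (mxrank_leqif_sup sLL')) rankL rankL'.
Qed.
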